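(* Let $C\subseteq\mathbb{R}^q$ be a polyhedral convex cone containing no lines, given by a matrix $Y\in\mathbb{R}^{q\times o}$ as $C=\{Yv : v\in\mathbb{R}^o,\ v\ge 0\}$, and let $c\in\operatorname{int} C$ with $c_q\neq 0$. Consider the vector linear program $$\min\nolimits_C\ Px\quad\text{subject to}\quad a\le Bx\le b,\quad l\le x\le s,$$ with $P\in\mathbb{R}^{q\times n}$, $B\in\mathbb{R}^{m\times n}$, $a\in(\mathbb{R}\cup\{-\infty\})^m$, $b\in(\mathbb{R}\cup\{+\infty\})^m$, $l\in(\mathbb{R}\cup\{-\infty\})^n$, $s\in(\mathbb{R}\cup\{+\infty\})^n$, and let $\mathcal{P}$ be its upper image. Let $\mathcal{D}$ be the lower image of the dual problem (both defined in the context). Define $$\varphi(y,y^* ) := c_q\sum_{i=1}^{q-1} y_i y_i^* + y_q\Bigl(\frac{|c_q|}{c_q}-\sum_{i=1}^{q-1} c_i y_i^*\Bigr)-\xi(y)\,|c_q|\,y_q^*,$$ where $\xi(y)=1$ if $y$ is a point and $\xi(y)=0$ if $y$ is a direction. If $\mathcal{P}$ has a vertex, then the following hold. (i) A finite set $\bar Y$ of points and directions in $\mathbb{R}^q$ is an irredundant V-representation of $\mathcal{P}$ if and only if the system of inequalities (in the variable $y^*\in\mathbb{R}^q$) $\varphi(y,y^* )\ge 0$, $y\in\bar Y$, is an irredundant H-representation of $\mathcal{D}$. (ii) A finite set $\bar W$ of points in $\mathbb{R}^q$ combined with the direction $(0,\dots,0,-1)^T$ forms an irredundant V-representation of $\mathcal{D}$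 if and only if the system of inequalities (in the variable point $y\in\mathbb{R}^q$, so $\xi(y)=1$) $\varphi(y,y^* )\ge 0$, $y^*\in\bar W$, is an irredundant H-representation of $\mathcal{P}$.
   Context: Here $n,m,q,o$ are positive integers. Inequalities between vectors are componentwise. The ordering is $y\le_C z :\iff z-y\in C$, and $\min_C$ means minimization with respect to $\le_C$. Upper image: with feasible set $S=\{x\in\mathbb{R}^n : a\le Bx\le b,\ l\le x\le s\}$, the upper image is $\mathcal{P}:=P[S]+C=\{Px+k : x\in S,\ k\in C\}$. Dual problem: let $K:=\{y\in\mathbb{R}^q : y_1=\dots=y_{q-1}=0,\ y_q\ge 0\}$. The dual problem is to $K$-maximize $D(u,w,v)$ subject to $$B^Tu=P^Tw+v,\quad Y^Tw\ge 0,\quad c^Tw=1,$$ over $(u,w,v)\in\mathbb{R}^m\times\mathbb{R}^q\times\mathbb{R}^n$, where $$D(u,w,v)=\Bigl(\tfrac{c_q}{|c_q|}w_1,\dots,\tfrac{c_q}{|c_q|}w_{q-1},\,d(u,v)\Bigr)^T,\qquad d(u,v)=a^Tu^+-b^Tu^-+l^Tv^--s^Tv^+.$$ Here $\alpha^+=\max(0,\alpha)$ and $\alpha^-=\max(-\alpha,0)$ for real $\alpha$, applied componentwise to vectors, and $\pm\infty\cdot 0=0$. A dual variable component ($u_i^+$, $u_i^-$, $v_j^-$ or $v_j^+$) multiplied by an infinite entry of $a,b,l,s$ must vanish; that is, the dual feasible set $T$ consists of those $(u,w,v)$ satisfying the constraints above for which $d(u,v)$ is finite. The lower image of the dual problem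 is $\mathcal{D}:=D[T]-K$. A V-representation of a polyhedron $Q\subseteq\mathbb{R}^q$ is a finite set of points and directions (each element carrying the tag ''point'' or ''direction'') such that $Q$ equals the convex hull of the points plus the convex cone generated by the directions. An H-representation of $Q$ is a finite system of affine inequalities whose solution set is $Q$. A representation is irredundant if no element (point, direction, or inequality) can be omitted without the result ceasing to represent $Q$.
   Formalization: Part (i) is stated only for q ≥ 2: for q = 1 it is false, since the irredundant V-representation of the half-line 𝒫 contains a direction whose inequality φ ≥ 0 is a positive constant, hence redundant (e.g. 𝒫 = [0,∞), c = 1). Part (ii) is kept for all q ≥ 1. *)

(* Defs.v *)
(* The objective space R^q is 'cV[R]_r.+1, i.e. q = r.+1 >= 1, and the
   distinguished q-th coordinate is ord_max. *)
From HB Require Import structures.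
From mathcomp Require Export all_boot all_order all_algebra finmap.
From mathcomp Require Export all_classical all_reals all_analysis.
Export Order.TTheory GRing.Theory Num.Theory.
Export numFieldNormedType.Exports.
Set Implicit Arguments.
Unset Strict Implicit.
Unset Printing Implicit Defensive.
#[global] Open Scope classical_set_scope.
#[global] Open Scope ring_scope.

Section Sets.
Variables (R : realType) (V : lmodType R).
Implicit Types (A B Q : set V) (F : {fset V}).

Definition minkowski_sum A B : set V := [set x + y | x in A & y in B].

Definition contains_no_lines A : Prop :=
  forall x d : V, (forall t : R, A (x + t *: d)) -> d = 0.

(* A vertex of a polyhedron is an extreme point. *)
Definition is_vertex Q (y : V) : Prop :=
  Q y /\ forall y1 y2 (t : R), Q y1 -> Q y2 -> 0 < t < 1 ->
    y = t *: y1 + (1 - t) *: y2 -> y1 = y /\ y2 = y.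

Definition has_vertex Q : Prop := exists y, is_vertex Q y.

(* The empty set has an empty convex hull but generates the cone {0}. *)
Definition conv_hull F : set V :=
  [set x | exists lam : V -> R, [/\ forall y, y \in F -> 0 <= lam y,
     \sum_(y <- F) lam y = 1 & x = \sum_(y <- F) lam y *: y]].

Definition cone_hull F : set V :=
  [set x | exists mu : V -> R, (forall y, y \in F -> 0 <= mu y) /\
     x = \sum_(y <- F) mu y *: y].

End Sets.

Section Representations.
Variables (R : realType) (k : nat).
Local Notation V := 'cV[R]_k.

(* A generator is a vector with its tag: true = point, false = direction. *)
Local Notation gen := (bool * V)%type.

Definition gpoint (y : V) : gen := (true, y).
Definition gdirection (y : V) : gen := (false, y).
Definition is_point (e : gen) : bool := e.1.
Definition vec (e : gen) : V := e.2.
Definition xi (e : gen) : R := if is_point e then 1 else 0.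

Definition points_of (A : {fset gen}) : {fset V} :=
  [fset vec e | e in A & is_point e]%fset.
Definition directions_of (A : {fset gen}) : {fset V} :=
  [fset vec e | e in A & ~~ is_point e]%fset.

Definition is_Vrep (A : {fset gen}) (Q : set V) : Prop :=
  Q = minkowski_sum (conv_hull (points_of A)) (cone_hull (directions_of A)).

Definition irredundant_Vrep (A : {fset gen}) (Q : set V) : Prop :=
  is_Vrep A Q /\ forall e, e \in A -> ~ is_Vrep (A `\ e)%fset Q.

Definition affine_functional (f : V -> R) : Prop :=
  exists (alpha : V) (beta : R), forall z, f z = (alpha^T *m z) 0 0 + beta.

(* The system { f i z >= 0 : i in J } in the unknown z. *)
Definition is_Hrep (I : choiceType) (J : {fset I}) (f : I -> V -> R)
    (Q : set V) : Prop :=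
  (forall i, i \in J -> affine_functional (f i)) /\
  Q = [set z | forall i, i \in J -> 0 <= f i z].

Definition irredundant_Hrep (I : choiceType) (J : {fset I}) (f : I -> V -> R)
    (Q : set V) : Prop :=
  is_Hrep J f Q /\ forall i, i \in J -> ~ is_Hrep (J `\ i)%fset f Q.

End Representations.

Section VectorLinearProgram.
Variables (R : realType) (n m r o : nat).
Local Notation last := (@ord_max r).

Variables (P : 'M[R]_(r.+1, n)) (B : 'M[R]_(m, n)).
Variables (a b : 'cV[\bar R]_m) (l s : 'cV[\bar R]_n).
Variables (Y : 'M[R]_(r.+1, o)) (c : 'cV[R]_r.+1).

Definition nonneg (k : nat) (x : 'cV[R]_k) : Prop := forall i, 0 <= x i 0.

Definition ordering_cone : set 'cV[R]_r.+1 := [set Y *m v | v in @nonneg o].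

Definition primal_feasible : set 'cV[R]_n :=
  [set x | (forall i, a i 0%R <= ((B *m x)%R i 0%R)%:E <= b i 0%R)%E /\
           (forall j, l j 0%R <= (x j 0%R)%:E <= s j 0%R)%E].

Definition upper_image : set 'cV[R]_r.+1 :=
  [set P *m x + k | x in primal_feasible & k in ordering_cone].

Definition ppart (t : R) : R := Num.max 0 t.
Definition npart (t : R) : R := Num.max (- t) 0.

(* In \bar R one has 0 * +oo = 0 * -oo = 0; since a, l < +oo and b, s > -oo,
   every infinite summand of the total is -oo. *)
Definition dual_value (u : 'cV[R]_m) (v : 'cV[R]_n) : \bar R :=
  (\sum_i a i 0%R * (ppart (u i 0%R))%:E - \sum_i b i 0%R * (npart (u i 0%R))%:E
   + \sum_j l j 0%R * (npart (v j 0%R))%:E - \sum_j s j 0%R * (ppart (v j 0%R))%:E)%E.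

Definition dual_feasible : set ('cV[R]_m * 'cV[R]_r.+1 * 'cV[R]_n) :=
  [set z | let: (u, w, v) := z in
    [/\ B^T *m u = P^T *m w + v, nonneg (Y^T *m w), (c^T *m w) 0 0 = 1
      & dual_value u v \is a fin_num]].

Definition dual_objective (z : 'cV[R]_m * 'cV[R]_r.+1 * 'cV[R]_n) :
    'cV[R]_r.+1 :=
  let: (u, w, v) := z in
  \col_i (if i == last then fine (dual_value u v)
          else c last 0 / `|c last 0| * w i 0).

Definition dual_cone : set 'cV[R]_r.+1 :=
  [set k | (forall i, i != last -> k i 0 = 0) /\ 0 <= k last 0].

Definition lower_image : set 'cV[R]_r.+1 :=
  [set dual_objective z - k | z in dual_feasible & k in dual_cone].

Definition phi (y : bool * 'cV[R]_r.+1) (ys : 'cV[R]_r.+1) : R :=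
  c last 0 * (\sum_(i | i != last) vec y i 0 * ys i 0)
  + vec y last 0 * (`|c last 0| / c last 0 - \sum_(i | i != last) c i 0 * ys i 0)
  - xi y * `|c last 0| * ys last 0.

End VectorLinearProgram.

(* Main.v *)
Require Import Defs.
From mathcomp Require Import ring lra.
Set Implicit Arguments.
Unset Strict Implicit.
Unset Printing Implicit Defensive.

(* Write a point of the dual space as z and let w(z) be the weight with
   c^T w = 1 that z encodes; then phi(y, z) = |c_q| (w(z)^T y - xi(y) z_q).
   Linear programming duality gives
   D = {z | phi(y, z) >= 0 for all points y of P}, and separating a point from P
   gives P = {y | phi(y, z) >= 0 for all z in D}.  By Farkas' lemma a
   V-representation of one of these polar sets is then exactly an
   H-representation of the other, up to the trivial inequality 1 >= 0.  For D
   that inequality is the vertical direction.  For P it is the direction c,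
   which is superfluous: c is the midpoint of c + e d and c - e d in C for some
   d not parallel to c, and P contains no line.  Since the correspondence holds
   for arbitrary finite systems, it carries irredundance over. *)

(** * Farkas' lemma *)

Section Farkas.
Context {R : realType}.

Lemma scalar0 (X : lmodType R) (f : X -> R) : scalar f -> f 0 = 0.
Proof. by move=> /(_ (-1) 0 0); rewrite scaler0 addr0 mulN1r addNr. Qed.

Lemma scalarD (X : lmodType R) (f : X -> R) (x y : X) :
  scalar f -> f (x + y) = f x + f y.
Proof. by move=> /(_ 1 x y); rewrite scale1r mul1r. Qed.

Lemma scalarZ (X : lmodType R) (f : X -> R) (t : R) (x : X) :
  scalar f -> f (t *: x) = t * f x.
Proof. by move=> fl; have := fl t x 0; rewrite addr0 scalar0 // addr0. Qed.

Lemma scalar_sum (X : lmodType R) (f : X -> R) (I : Type) (s : seq I)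
    (F : I -> X) :
  scalar f -> f (\sum_(i <- s) F i) = \sum_(i <- s) f (F i).
Proof.
move=> fl; elim: s => [|i s IH]; first by rewrite !big_nil scalar0.
by rewrite !big_cons scalarD // IH.
Qed.

(* Bartl's induction on the number of functionals: if x0 satisfies all of them
   except f j but g x0 < 0, project along x0 onto the kernel of f j. *)
Lemma farkas (X : lmodType R) (I : eqType) (s : seq I) (f : I -> X -> R)
    (g : X -> R) :
  uniq s -> (forall i, scalar (f i)) -> scalar g ->
  (forall x, (forall i, i \in s -> 0 <= f i x) -> 0 <= g x) ->
  exists2 lam : I -> R, forall i, 0 <= lam i
    & forall x, g x = \sum_(i <- s) lam i * f i x.
Proof.
elim: s f g => [|j s IH] f g.
  (* Without constraints [g] is nonnegative at both [x] and [-x], so it vanishes identically. *)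
  move=> _ _ gl g0; exists (fun=> 0) => // x; rewrite big_nil; apply/eqP.
  rewrite eq_le g0 // andbT -oppr_ge0 -mulN1r -scalarZ //.
  exact: g0.
move=> /= /andP[js us] fl gl fg.
have sumj (lam : I -> R) t x :
    \sum_(i <- j :: s) (if i == j then t else lam i) * f i x =
    t * f j x + \sum_(i <- s) lam i * f i x.
  rewrite big_cons eqxx; congr (_ + _); apply: eq_big_seq => i si.
  by case: eqP => // ij; rewrite -ij si in js.
have [fgs|] := pselect (forall x, (forall i, i \in s -> 0 <= f i x) -> 0 <= g x).
  have [lam lam0 glam] := IH f g us fl gl fgs.
  exists (fun i => if i == j then 0 else lam i).
    by move=> i; case: eqP.
  by move=> x; rewrite sumj mul0r add0r.
move=> /existsNP[x0 /not_implyP[fx0 /negP]]; rewrite -ltNge => gx0.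
have fjx0 : f j x0 < 0.
  rewrite ltNge; apply/negP => fjx0; move: gx0; rewrite ltNge => /negP; apply.
  by apply: fg => i; rewrite inE => /predU1P[->|/fx0].
have fj0 : f j x0 != 0 by rewrite lt_eqF.
(* [proj] annihilates [f j], and since [f j x0 < 0] it subtracts a nonnegative multiple of [x0]
   exactly when [f j x <= 0]. *)
pose proj x := x - (f j x / f j x0) *: x0.
have proj_lin h : scalar h -> forall x, h (proj x) = h x - f j x / f j x0 * h x0.
  by move=> hl x; rewrite /proj [x - _]addrC -scaleNr hl addrC mulNr.
have projl h : scalar h -> scalar (h \o proj).
  by move=> hl t x y; rewrite /comp !proj_lin // hl fl; field.
have [|lam lam0 glam] := IH (fun i => f i \o proj) (g \o proj) us
    (fun i => projl _ (fl i)) (projl _ gl).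
  move=> x fx; apply: fg => i; rewrite inE => /predU1P[->|/fx //].
  by rewrite proj_lin // divfK // subrr.
(* The value that makes the desired identity hold at [x0]; numerator and denominator are both
   negative. *)
pose t := (g x0 - \sum_(i <- s) lam i * f i x0) / f j x0.
exists (fun i => if i == j then t else lam i).
  move=> i; case: eqP => // _; rewrite /t -mulrNN -invrN mulr_ge0 //.
    rewrite opprB subr_ge0 (le_trans (ltW gx0)) // big_seq sumr_ge0 // => k ks.
    by rewrite mulr_ge0 // fx0.
  by rewrite invr_ge0 oppr_ge0 ltW.
move=> x; rewrite sumj /t.
have := glam x; rewrite /= proj_lin // => /eqP; rewrite subr_eq => /eqP ->.
under eq_bigr => i _ do rewrite proj_lin // mulrBr.
rewrite sumrB.
have -> : \sum_(i <- s) lam i * (f j x / f j x0 * f i x0) =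
   f j x / f j x0 * \sum_(i <- s) lam i * f i x0.
  by rewrite mulr_sumr; apply: eq_bigr => i _; ring.
by field.
Qed.

Lemma scalar_homogenize (X : lmodType R) (g : X -> R) (h : R) :
  scalar g -> scalar (fun z : X * R^o => g z.1 + h * z.2).
Proof. by move=> gl t [x1 t1] [x2 t2] /=; rewrite gl /GRing.scale/=; ring. Qed.

(** A real coordinate [t] is adjoined to make the affine functions linear. The key [None] stands for
    the extra constraint [t >= 0], whose multiplier is [mu]; the conclusion is the Farkas identity
    at [t = 1]. *)
Lemma homogenized_system (X : lmodType R) (I : eqType) (s : seq I)
    (g : I -> X -> R) (h : I -> R) (g0 : X -> R) (h0 : R) :
  uniq s -> (forall i, scalar (g i)) -> scalar g0 ->
  (forall x t, 0 <= t -> (forall i, i \in s -> 0 <= g i x + h i * t) ->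
     0 <= g0 x + h0 * t) ->
  exists (lam : I -> R) (mu : R), [/\ forall i, 0 <= lam i, 0 <= mu
    & forall x, g0 x + h0 = \sum_(i <- s) lam i * (g i x + h i) + mu].
Proof.
move=> us gl g0l sys.
pose f (k : option I) (z : X * R^o) : R :=
  if k is Some i then g i z.1 + h i * z.2 else z.2.
have [||||lam lam0 glam] := @farkas (X * R^o)%type (option I)
    (None :: map some s) f (fun z => g0 z.1 + h0 * z.2).
- rewrite /= map_inj_uniq ?us ?andbT; last by move=> ? ? [].
  by apply/mapP => -[].
- by move=> [i|] //=; exact: scalar_homogenize.
- exact: scalar_homogenize.
- move=> [x t] fx /=; apply: sys.
    by have := fx None; rewrite inE eqxx => /(_ isT).
  by move=> i si; have := fx (Some i); rewrite inE map_f //; apply.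
exists (lam \o some), (lam None); split=> //= x.
have := glam (x, 1); rewrite /= big_cons big_map /= !mulr1 => ->.
by rewrite addrC; congr (_ + _); apply: eq_bigr => i _; rewrite mulr1.
Qed.

(** The implication extends from [t = 1] to all [t >= 0]: by scaling if [t > 0], and if [t = 0]
    because [x] is then a direction in which one can move from the feasible point [x0] forever. *)
Lemma affine_farkas (X : lmodType R) (I : eqType) (s : seq I)
    (g : I -> X -> R) (h : I -> R) (g0 : X -> R) (h0 : R) (x0 : X) :
  uniq s -> (forall i, scalar (g i)) -> scalar g0 ->
  (forall i, i \in s -> 0 <= g i x0 + h i) ->
  (forall x, (forall i, i \in s -> 0 <= g i x + h i) -> 0 <= g0 x + h0) ->
  exists (lam : I -> R) (mu : R), [/\ forall i, 0 <= lam i, 0 <= mu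
    & forall x, g0 x + h0 = \sum_(i <- s) lam i * (g i x + h i) + mu].
Proof.
move=> us gl g0l fx0 cons; apply: homogenized_system => // x t.
rewrite le_eqVlt => /predU1P[<-|t0] fx.
  rewrite mulr0 addr0 leNgt; apply/negP => gx0.
  (* Moving this far along [x] from [x0] brings the target [g0 + h0] down to [-1]. *)
  pose k := (g0 x0 + h0 + 1) / - g0 x.
  have gx0k : 0 <= g0 x0 + h0 by exact: cons.
  have k0 : 0 <= k by rewrite divr_ge0 //; lra.
  have : 0 <= g0 (k *: x + x0) + h0.
    apply: cons => i si; rewrite gl -addrA addr_ge0 ?fx0 // mulr_ge0 //.
    by have := fx i si; rewrite mulr0 addr0.
  rewrite g0l.
  have -> : k * g0 x = - (g0 x0 + h0 + 1) by rewrite /k; field; rewrite lt_eqF.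
  by lra.
have scale g' h' : scalar g' -> g' x + h' * t = t * (g' (t^-1 *: x) + h').
  by move=> g'l; rewrite (scalarZ _ _ g'l); field; rewrite gt_eqF.
rewrite scale // pmulr_rge0 //; apply: cons => i si.
by rewrite -(pmulr_rge0 _ t0) -scale // fx.
Qed.

(** The target of the homogenized implication is [- t >= 0]: a solution with [t > 0] would rescale
    to a feasible point. *)
Lemma infeasible_farkas (X : lmodType R) (I : eqType) (s : seq I)
    (g : I -> X -> R) (h : I -> R) :
  uniq s -> (forall i, scalar (g i)) ->
  (forall x, ~ (forall i, i \in s -> 0 <= g i x + h i)) ->
  exists2 lam : I -> R, forall i, 0 <= lam i
    & forall x, \sum_(i <- s) lam i * (g i x + h i) <= - 1.
Proof.
move=> us gl nfeas.
have [||||lam [mu [lam0 mu0 eq_lam]]] :=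
    @homogenized_system X I s g h (fun=> 0) (- 1) => //.
- by move=> t x y; rewrite mulr0 addr0.
- move=> x t; rewrite le_eqVlt => /predU1P[<-|t0] fx; first by rewrite mulr0 addr0.
  exfalso; apply: (nfeas (t^-1 *: x)) => i si; rewrite -(pmulr_rge0 _ t0).
  rewrite (scalarZ _ _ (gl i)) mulrDr mulrA divff ?gt_eqF // mul1r [t * _]mulrC.
  exact: fx.
exists lam => // x; have := eq_lam x; rewrite add0r => ->.
by rewrite lerDl.
Qed.

End Farkas.

(** * Linear programming duality *)

Section DotProduct.
Context {R : realType}.

Definition dot k (x y : 'cV[R]_k) : R := (x^T *m y) 0 0.

Lemma dotE k (x y : 'cV[R]_k) : dot x y = \sum_i x i 0 * y i 0.
Proof. by rewrite /dot mxE; apply: eq_bigr => i _; rewrite mxE. Qed.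

Lemma dotC k (x y : 'cV[R]_k) : dot x y = dot y x.
Proof. by rewrite !dotE; apply: eq_bigr => i _; rewrite mulrC. Qed.

Lemma dot_scalar k (x : 'cV[R]_k) : scalar (dot x).
Proof. by move=> t y z; rewrite /dot mulmxDr -scalemxAr !mxE. Qed.

Lemma dotDr k (x y z : 'cV[R]_k) : dot x (y + z) = dot x y + dot x z.
Proof. exact/scalarD/dot_scalar. Qed.

Lemma dotZr k (x y : 'cV[R]_k) t : dot x (t *: y) = t * dot x y.
Proof. exact/scalarZ/dot_scalar. Qed.

Lemma dotNr k (x y : 'cV[R]_k) : dot x (- y) = - dot x y.
Proof. by rewrite -scaleN1r dotZr mulN1r. Qed.

Lemma dotDl k (x y z : 'cV[R]_k) : dot (x + y) z = dot x z + dot y z.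
Proof. by rewrite dotC dotDr ![dot z _]dotC. Qed.

Lemma dotNl k (x y : 'cV[R]_k) : dot (- x) y = - dot x y.
Proof. by rewrite dotC dotNr dotC. Qed.

Lemma dotZl k (x y : 'cV[R]_k) t : dot (t *: x) y = t * dot x y.
Proof. by rewrite dotC dotZr dotC. Qed.

Lemma dot0r k (x : 'cV[R]_k) : dot x 0 = 0.
Proof. exact/scalar0/dot_scalar. Qed.

Lemma dot_delta k (x : 'cV[R]_k) i : dot x (delta_mx i 0) = x i 0.
Proof.
rewrite dotE (bigD1 i) //= mxE !eqxx mulr1 big1 ?addr0 // => j ji.
by rewrite mxE (negbTE ji) mulr0.
Qed.

Lemma dot_mulmxr k p (M : 'M[R]_(k, p)) w x : dot w (M *m x) = dot (M^T *m w) x.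
Proof. by rewrite /dot trmx_mul trmxK mulmxA. Qed.

Lemma dot_eq k (x y : 'cV[R]_k) : (forall z, dot x z = dot y z) -> x = y.
Proof.
by move=> xy; apply/colP => i; have := xy (delta_mx i 0); rewrite !dot_delta.
Qed.

Lemma dot_gt0 k (x : 'cV[R]_k) : x != 0 -> 0 < dot x x.
Proof.
move=> x0; rewrite lt_neqAle dotE sumr_ge0 ?andbT => [|i _]; last first.
  by rewrite -expr2 sqr_ge0.
apply: contra x0; rewrite eq_sym => /eqP s0.
apply/eqP/colP => i; rewrite mxE.
have := psumr_eq0P (fun j _ => _ : 0 <= x j 0 * x j 0) s0.
move=> /(_ _ i isT) /eqP; rewrite -expr2 sqrf_eq0 => h; apply/eqP/h => j.
by rewrite -expr2 sqr_ge0.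
Qed.

Lemma nonneg_dot k (x y : 'cV[R]_k) : nonneg x -> nonneg y -> 0 <= dot x y.
Proof. by move=> x0 y0; rewrite dotE sumr_ge0 // => i _; rewrite mulr_ge0. Qed.

(** The recurring recession argument: an inequality valid along a whole ray constrains the direction
    of the ray. If [q < 0], the value [-1] is reached at [t = (p + 1) / - q]. *)
Lemma affine_ray_ge0 (p q : R) : (forall t, 0 <= t -> 0 <= p + t * q) -> 0 <= q.
Proof.
move=> ray; rewrite leNgt; apply/negP => q0.
have p0 : 0 <= p by have := ray 0 (lexx _); rewrite mul0r addr0.
have /ray : 0 <= (p + 1) / - q by rewrite divr_ge0 //; lra.
have -> : (p + 1) / - q * q = - (p + 1) by field; rewrite lt_eqF.
by lra.
Qed.

End DotProduct.

(** * Possibly infinite bounds and their multipliers *)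

Section Bounds.
Context {R : realType}.
Implicit Types (a b : \bar R) (x p q : R).

(** Over [R] every bound becomes an affine inequality, as Farkas' lemma requires; an infinite bound
    yields [0 <= 0]. *)
Lemma lower_boundE a x : a <> +oo%E ->
  (a <= x%:E)%E = (0 <= (a \is a fin_num)%:R * x + - fine a).
Proof.
case: a => [a||] // _; first by rewrite lee_fin /= mul1r subr_ge0.
by rewrite leNye /= mul0r oppr0 addr0 lexx.
Qed.

Lemma upper_boundE b x : b <> -oo%E ->
  (x%:E <= b)%E = (0 <= - (b \is a fin_num)%:R * x + fine b).
Proof.
case: b => [b||] // _; first by rewrite lee_fin /= mulN1r addrC subr_ge0.
by rewrite leey /= oppr0 mul0r addr0 lexx.
Qed.

Lemma ppartN (t : R) : ppart (- t) = npart t.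
Proof. by rewrite /ppart /npart maxC. Qed.

Lemma ppart_ge0 (t : R) : 0 <= ppart t.
Proof. by rewrite /ppart le_max lexx. Qed.

Lemma npart_ge0 (t : R) : 0 <= npart t.
Proof. by rewrite -ppartN ppart_ge0. Qed.

Lemma ppartBnpart (t : R) : ppart t - npart t = t.
Proof. rewrite /ppart /npart /Num.max; by case: ltP => ?; case: ltP => ?; lra. Qed.

(** The equation on [p] says that [p] vanishes at an infinite bound. Then [p - q <= 0] has positive
    part zero, and both products are zero. *)
Lemma infinite_ppart a p q : a <> +oo%E -> 0 <= q ->
  p * (a \is a fin_num)%:R = p ->
  (a * (ppart (p - q))%:E)%E = (fine a * ppart (p - q))%:E.
Proof.
case: a => [a||] //= _ q0; rewrite mulr0 => <-.
suff -> : ppart (0 - q) = 0 by rewrite mule0 mulr0.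
by rewrite /ppart; apply/max_idPl; lra.
Qed.

Lemma infinite_npart b p q : b <> -oo%E -> 0 <= p ->
  q * (b \is a fin_num)%:R = q ->
  (b * (npart (p - q))%:E)%E = (fine b * npart (p - q))%:E.
Proof.
case: b => [b||] //= _ p0; rewrite mulr0 => <-.
suff -> : npart (p - 0) = 0 by rewrite mule0 mulr0.
by rewrite /npart; apply/max_idPr; lra.
Qed.

(* Cancelling the common part min(p, q) of two opposite multipliers only
   improves the dual value, because a <= b. *)
Lemma cancel_multipliers a b p q :
  (a <= b)%E -> 0 <= p -> 0 <= q ->
  p * (a \is a fin_num)%:R = p -> q * (b \is a fin_num)%:R = q ->
  fine a * p - fine b * q <= fine a * ppart (p - q) - fine b * npart (p - q).
Proof.
move=> ab p0 q0 pa qb.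
(* Here [t] stands for the smaller of [p] and [q]; an infinite bound forces its multiplier, hence
   [t], to be zero. *)
have common (t : R) : 0 <= t -> t <= p -> t <= q -> fine a * t <= fine b * t.
  move=> t0; have t_eq0 : p = 0 \/ q = 0 -> t <= p -> t <= q -> t = 0.
    by move=> pq tp tq; apply/eqP; rewrite eq_le t0 andbT; case: pq; lra.
  case: a b ab pa qb => [a||] [b||] //=; rewrite ?lee_fin ?mulr0 => ab pa qb tp tq.
  - by rewrite ler_wpM2r.
  - by rewrite t_eq0 ?mulr0 //; right.
  - by rewrite t_eq0 ?mulr0 //; left.
rewrite /ppart /npart; case: (leP p q) => pq.
  have [-> ->] : Num.max 0 (p - q) = 0 /\ Num.max (- (p - q)) 0 = q - p.
    by split; [apply/max_idPl|rewrite opprB; apply/max_idPl]; lra.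
  by have := common p p0 (lexx _) pq; lra.
have [-> ->] : Num.max 0 (p - q) = p - q /\ Num.max (- (p - q)) 0 = 0.
  by split; [apply/max_idPr|apply/max_idPr]; lra.
by have := common q q0 (ltW pq) (lexx _); lra.
Qed.

End Bounds.

(** * Weak and strong duality for two-sided bounds *)

Section LinearProgram.
Context {R : realType} {n m : nat}.
Variables (B : 'M[R]_(m, n)).
Variables (a b : 'cV[\bar R]_m) (l s : 'cV[\bar R]_n).
Hypothesis a_lty : forall i, a i 0 <> +oo%E.
Hypothesis b_gtNy : forall i, b i 0 <> -oo%E.
Hypothesis l_lty : forall j, l j 0 <> +oo%E.
Hypothesis s_gtNy : forall j, s j 0 <> -oo%E.
Local Notation S := (primal_feasible B a b l s).

Definition constraint := (('I_m + 'I_m) + ('I_n + 'I_n))%type.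

(* As fine +-oo = 0, an infinite bound becomes the void constraint 0 <= 0. *)
Definition constraint_lin (k : constraint) (x : 'cV[R]_n) : R :=
  match k with
  | inl (inl i) => (a i 0%R \is a fin_num)%:R * (B *m x) i 0
  | inl (inr i) => - (b i 0%R \is a fin_num)%:R * (B *m x) i 0
  | inr (inl j) => (l j 0%R \is a fin_num)%:R * x j 0
  | inr (inr j) => - (s j 0%R \is a fin_num)%:R * x j 0
  end.

Definition constraint_cst (k : constraint) : R :=
  match k with
  | inl (inl i) => - fine (a i 0%R)
  | inl (inr i) => fine (b i 0%R)
  | inr (inl j) => - fine (l j 0%R)
  | inr (inr j) => fine (s j 0%R)
  end.

Lemma constraint_scalar k : scalar (constraint_lin k).
Proof.
move: k => [[i|i]|[j|j]] t x y; rewrite /= ?mulmxDr -?scalemxAr !mxE; ring.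
Qed.

Lemma primal_feasibleP x :
  S x <-> forall k, 0 <= constraint_lin k x + constraint_cst k.
Proof.
split=> [[abx lsx]|Sx].
  move=> [[i|i]|[j|j]] /=; first 2 last.
  - by have /andP[+ _] := lsx j; rewrite lower_boundE.
  - by have /andP[_] := lsx j; rewrite upper_boundE.
  - by have /andP[+ _] := abx i; rewrite lower_boundE.
  - by have /andP[_] := abx i; rewrite upper_boundE.
split=> [i|j]; rewrite lower_boundE // upper_boundE //.
  by rewrite (Sx (inl (inl i))) (Sx (inl (inr i))).
by rewrite (Sx (inr (inl j))) (Sx (inr (inr j))).
Qed.

(** Substituting [g = B^T u - v] and splitting [u] and [v] into their parts, each bound of [S] is
    multiplied by a nonnegative part. Comparing termwise in the extended reals spares a case
    distinction on infinite bounds. *)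
Lemma weak_duality (g v : 'cV[R]_n) (u : 'cV[R]_m) x :
  B^T *m u = g + v -> S x -> (dual_value a b l s u v <= (dot g x)%:E)%E.
Proof.
move=> uv [abx lsx].
have -> : dot g x = \sum_i (B *m x) i 0 * ppart (u i 0)
    - \sum_i (B *m x) i 0 * npart (u i 0) + \sum_j x j 0 * npart (v j 0)
    - \sum_j x j 0 * ppart (v j 0).
  have -> : g = B^T *m u - v by rewrite uv addrK.
  rewrite dotDl dotNl -dot_mulmxr -addrA -!sumrB !dotE -sumrN -?big_split /=.
  congr (_ + _); apply: eq_bigr => i _.
    by rewrite -mulrBr ppartBnpart mulrC.
  by rewrite -{1}[v i 0]ppartBnpart; ring.
rewrite /dual_value EFinB EFinD EFinB -!sumEFin.
apply: leeB; [apply: leeD; [apply: leeB|]|]; apply: lee_sum => k _;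
  rewrite EFinM lee_wpmul2r ?lee_fin ?ppart_ge0 ?npart_ge0 //.
- by have /andP[] := abx k.
- by have /andP[] := abx k.
- by have /andP[] := lsx k.
- by have /andP[] := lsx k.
Qed.

(** Farkas' lemma writes [dot g x - beta] as a nonnegative combination of the constraints plus a
    constant; differences of opposite multipliers give [u] and [v]. *)
Lemma strong_duality (g : 'cV[R]_n) beta x0 :
  S x0 -> (forall x, S x -> beta <= dot g x) ->
  exists (u : 'cV[R]_m) (v : 'cV[R]_n), [/\ B^T *m u = g + v,
    dual_value a b l s u v \is a fin_num
    & beta <= fine (dual_value a b l s u v)].
Proof.
move=> Sx0 S_beta.
have [||lam [mu [lam0 mu0 dual]]] :=
  @affine_farkas R _ _ (index_enum constraint) constraint_lin constraint_cst
    (dot g) (- beta) x0 (index_enum_uniq _) constraint_scalar (dot_scalar g).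
- by move=> k _; exact: (primal_feasibleP x0).1.
- move=> x Sx; rewrite subr_ge0 S_beta //; apply/primal_feasibleP => k.
  exact/Sx/mem_index_enum.
(* Multipliers of void constraints are reset to zero. This leaves the Farkas identity unchanged and
   keeps the dual value finite. *)
pose eff (e : \bar R) t : R := t * (e \is a fin_num)%:R.
pose pa := \col_i eff (a i 0) (lam (inl (inl i))).
pose pb := \col_i eff (b i 0) (lam (inl (inr i))).
pose pl := \col_j eff (l j 0) (lam (inr (inl j))).
pose ps := \col_j eff (s j 0) (lam (inr (inr j))).
have eff_ge0 e t : 0 <= t -> 0 <= eff e t by move=> t0; rewrite mulr_ge0.
have eff_id e t : eff e t * (e \is a fin_num)%:R = eff e t.
  by rewrite /eff -mulrA -natrM mulnb andbb.
have eff_fine e t : t * fine e = fine e * eff e t.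
  by rewrite /eff; case: e => [e||] /=; ring.
have gE x : dot g x - beta = dot pa (B *m x) - dot pb (B *m x) + dot pl x
   - dot ps x - \sum_i fine (a i 0) * pa i 0 + \sum_i fine (b i 0) * pb i 0
   - \sum_j fine (l j 0) * pl j 0 + \sum_j fine (s j 0) * ps j 0 + mu.
  have lower k (e : 'cV[\bar R]_k) (lm : 'I_k -> R) (y : 'cV[R]_k)
      (p := \col_i eff (e i 0) (lm i)) :
    \sum_i lm i * ((e i 0%R \is a fin_num)%:R * y i 0 - fine (e i 0%R)) =
    dot p y - \sum_i fine (e i 0) * p i 0.
    rewrite dotE -sumrB; apply: eq_bigr => i _.
    by rewrite mulrBr eff_fine /p mxE /eff !mulrA.
  have upper k (e : 'cV[\bar R]_k) (lm : 'I_k -> R) (y : 'cV[R]_k)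
      (p := \col_i eff (e i 0) (lm i)) :
    \sum_i lm i * (- (e i 0%R \is a fin_num)%:R * y i 0 + fine (e i 0%R)) =
    - dot p y + \sum_i fine (e i 0) * p i 0.
    rewrite dotE -sumrN -big_split; apply: eq_bigr => i _.
    by rewrite mulrDr eff_fine /p mxE /eff mulNr mulrN !mulrA.
  rewrite dual !big_sumType /= !lower !upper -/pa -/pb -/pl -/ps.
  by ring.
exists (pa - pb), (ps - pl).
(* The constant term of the Farkas identity, read off at [x = 0]. *)
have betaE : beta = \sum_i (fine (a i 0) * pa i 0 - fine (b i 0) * pb i 0)
   + \sum_j (fine (l j 0) * pl j 0 - fine (s j 0) * ps j 0) - mu.
  by have := gE 0; rewrite mulmx0 !dot0r !sumrB; lra.
have a_le_b i : (a i 0%R <= b i 0%R)%E.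
  by have [/(_ i)/andP[+ +] _] := Sx0; exact: le_trans.
have l_le_s j : (l j 0%R <= s j 0%R)%E.
  by have [_ /(_ j)/andP[+ +]] := Sx0; exact: le_trans.
have valE : dual_value a b l s (pa - pb) (ps - pl) =
   (\sum_i (fine (a i 0) * ppart (pa i 0 - pb i 0)
             - fine (b i 0) * npart (pa i 0 - pb i 0)) +
    \sum_j (fine (l j 0) * ppart (pl j 0 - ps j 0)
             - fine (s j 0) * npart (pl j 0 - ps j 0)))%:E.
  rewrite !sumrB addrA EFinB EFinD EFinB -!sumEFin /dual_value.
  congr (_ - _ + _ - _)%E; apply: eq_bigr => k _.
  - by rewrite -infinite_ppart ?mxE ?eff_id ?eff_ge0.
  - by rewrite -infinite_npart ?mxE ?eff_id ?eff_ge0.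
  - by rewrite -infinite_ppart ?mxE ?eff_id ?eff_ge0 // -ppartN opprB.
  - by rewrite -infinite_npart ?mxE ?eff_id ?eff_ge0 // -ppartN opprB.
split; last 2 first.
- by rewrite valE.
- rewrite valE betaE /= lerBlDr -[leLHS]addr0 lerD //.
  by apply: lerD; apply: ler_sum => k _; apply: cancel_multipliers;
    rewrite ?mxE ?eff_id ?eff_ge0.
(* Subtracting the identity at [0] leaves its linear part, which is the dual equation tested on
   [x]. *)
apply: dot_eq => x; have := gE 0; have := gE x.
rewrite mulmx0 !dot0r dotDl -dot_mulmxr !dotDl !dotNl; lra.
Qed.

End LinearProgram.

(** * Polarity of the upper and the lower image *)

Section GeometricDuality.
Context {R : realType} {n m r o : nat}.
Variables (P : 'M[R]_(r.+1, n)) (B : 'M[R]_(m, n)).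
Variables (a b : 'cV[\bar R]_m) (l s : 'cV[\bar R]_n).
Variables (Y : 'M[R]_(r.+1, o)) (c : 'cV[R]_r.+1).
Hypothesis a_lty : forall i, a i 0 <> +oo%E.
Hypothesis b_gtNy : forall i, b i 0 <> -oo%E.
Hypothesis l_lty : forall j, l j 0 <> +oo%E.
Hypothesis s_gtNy : forall j, s j 0 <> -oo%E.
Hypothesis c_int : interior (ordering_cone Y) c.
Hypothesis c_last : c ord_max 0 <> 0.
Local Notation last := (@ord_max r).
Local Notation S := (primal_feasible B a b l s).
Local Notation UI := (upper_image P B a b l s Y).
Local Notation LI := (lower_image P B a b l s Y c).

Definition sgnc := c last 0 / `|c last 0|.

(* The weight w with c^T w = 1 whose image under D has the same first q - 1
   coordinates as ys. *)
Definition weight (ys : 'cV[R]_r.+1) : 'cV[R]_r.+1 :=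
  \col_i (if i == last
          then (1 - \sum_(j | j != last) c j 0 * (sgnc * ys j 0)) / c last 0
          else sgnc * ys i 0).

Let c_neq0 : c last 0 != 0. Proof. exact/eqP. Qed.
Let normc_neq0 : `|c last 0| != 0. Proof. by rewrite normr_eq0. Qed.

Lemma sgnc_sqr : sgnc * sgnc = 1.
Proof.
rewrite /sgnc mulrACA -invfM -!expr2 real_normK ?num_real //.
by rewrite divff // sqrf_eq0.
Qed.

Lemma dot_last (x y : 'cV[R]_r.+1) :
  dot x y = \sum_(j | j != last) x j 0 * y j 0 + x last 0 * y last 0.
Proof. by rewrite dotE (bigD1 last) //= addrC. Qed.

Lemma dot_weight ys : dot c (weight ys) = 1.
Proof.
rewrite dot_last [weight ys last 0]mxE eqxx mulrC divfK //.
under eq_bigr => j jl do rewrite mxE (negbTE jl).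
by rewrite addrC subrK.
Qed.

(** As [c_q <> 0], the normalization [c^T w = 1] determines [w_q] from the other coordinates, so
    dropping [w_q] in the dual objective loses nothing. *)
Lemma weight_uniq (ys w : 'cV[R]_r.+1) : dot c w = 1 ->
  (forall j, j != last -> ys j 0 = sgnc * w j 0) -> weight ys = w.
Proof.
move=> cw1 ysw; apply/colP => i; rewrite mxE; case: eqP => [->|/eqP il].
  under eq_bigr => j jl do rewrite ysw // [sgnc * (_ * _)]mulrA sgnc_sqr mul1r.
  by move: cw1; rewrite dot_last => <-; rewrite addrC addKr mulrC mulKf.
by rewrite ysw // mulrA sgnc_sqr mul1r.
Qed.

(** Since [|c_q|] is positive, the sign of [phi] becomes a comparison of [w^T y] with the last dual
    coordinate. The computation rests on [|c_q| * sgnc = c_q] and [sgnc * sgnc = 1]. *)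
Lemma phi_weight e ys :
  phi c e ys = `|c last 0| * (dot (weight ys) (vec e) - xi e * ys last 0).
Proof.
rewrite /phi [in RHS]mulrBr; congr (_ - _); last by ring.
rewrite dot_last [weight ys last 0]mxE eqxx.
under [in RHS]eq_bigr => j jl do rewrite mxE (negbTE jl) -mulrA.
under [X in 1 - X]eq_bigr => j jl do rewrite mulrCA.
rewrite -!mulr_sumr.
have -> : \sum_(j < r.+1 | j != last) ys j 0 * vec e j 0 =
          \sum_(j < r.+1 | j != last) vec e j 0 * ys j 0.
  by apply: eq_bigr => j _; rewrite mulrC.
have -> : `|c last 0| / c last 0 = sgnc.
  apply: (mulIf c_neq0); rewrite divfK // /sgnc.
  by rewrite mulrAC -expr2 -real_normK ?num_real // expr2 mulfK.
have cE : `|c last 0| * sgnc = c last 0 by rewrite /sgnc mulrC divfK.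
rewrite [in RHS]mulrDr [in RHS]mulrA cE; congr (_ + _).
have -> : `|c last 0| = c last 0 * sgnc by rewrite -{2}cE -mulrA sgnc_sqr mulr1.
set T := (\sum_(j < r.+1 | _) _).
have -> : c last 0 * sgnc * ((1 - sgnc * T) / c last 0 * vec e last 0) =
  (sgnc - sgnc * sgnc * T) * vec e last 0 by field.
by rewrite sgnc_sqr; ring.
Qed.

Lemma upper_image_ray (d y : 'cV[R]_r.+1) t :
  ordering_cone Y d -> 0 <= t -> UI y -> UI (y + t *: d).
Proof.
move=> [v v0 <-] t0 [x Sx [_ [v' v'0 <-] <-]].
exists x => //; exists (Y *m (v' + t *: v)).
  by exists (v' + t *: v) => // i; rewrite !mxE addr_ge0 // mulr_ge0.
by rewrite mulmxDr -scalemxAr addrA.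
Qed.

Lemma cone_col j : ordering_cone Y (Y *m delta_mx j 0).
Proof. by exists (delta_mx j 0) => // i; rewrite mxE ler0n. Qed.

(** Forward, weak duality is combined with [w^T k >= 0] for [k] in the cone. Backward, [w] is the
    weight of [ys], and strong duality for the objective [P^T w] supplies [u] and [v]. *)
Lemma lower_image_polar ys : (exists y, UI y) ->
  LI ys <-> (forall y, UI y -> 0 <= phi c (gpoint y) ys).
Proof.
move=> [y0 UIy0]; split.
  move=> [[[u w] v] [uwv Yw cw fin] [k [k0 kl] <-]] _ [x Sx [_ [z z0 <-] <-]].
  have weq : weight (dual_objective a b l s c (u, w, v) - k) = w.
    by apply: weight_uniq => // j jl; rewrite !mxE (negbTE jl) k0 // oppr0 addr0.
  rewrite phi_weight weq mulr_ge0 // subr_ge0 /= mul1r !mxE eqxx.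
  have := weak_duality uwv Sx; rewrite -(fineK fin) lee_fin => wd.
  rewrite dotDr !dot_mulmxr; have := nonneg_dot Yw z0; lra.
move=> polar.
have {}polar y : UI y -> ys last 0 <= dot (weight ys) y.
  move=> /polar; rewrite phi_weight pmulr_rge0 ?normr_gt0 //.
  by rewrite subr_ge0 /= mul1r.
have Yw : nonneg (Y^T *m weight ys).
  move=> j; rewrite -dot_delta -dot_mulmxr.
  (* The upper image contains the ray from [y0] along each column of [Y]. *)
  apply: (@affine_ray_ge0 _ (dot (weight ys) y0 - ys last 0)) => t t0.
  rewrite -dotZr addrAC -dotDr subr_ge0; apply: polar.
  by apply: upper_image_ray => //; exact: cone_col.
have [x0 Sx0 _] := UIy0.
have [|u [v [uv fin]]] :=
   @strong_duality R n m B a b l s a_lty b_gtNy l_lty s_gtNy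
     (P^T *m weight ys) (ys last 0) x0 Sx0.
  move=> x Sx; rewrite -dot_mulmxr; apply: polar.
  exists x => //; exists 0; last by rewrite addr0.
  by exists 0; [move=> i; rewrite mxE|rewrite mulmx0].
move=> ys_le.
exists (u, weight ys, v); first by split=> //; exact: dot_weight.
(* The excess of the dual value over [ys_q] is the only nonzero coordinate of this element of the
   dual cone. *)
exists (dual_objective a b l s c (u, weight ys, v) - ys); last by rewrite subKr.
split=> [i il|]; rewrite !mxE ?eqxx ?(negbTE il) ?subr_ge0 //.
by rewrite mulrA sgnc_sqr mul1r subrr.
Qed.

(** Continuity of [t |-> c + t d] at [0]; half the radius keeps both points inside the open ball. *)
Lemma interior_ray (d : 'cV[R]_r.+1) : exists2 e : R, 0 < e
  & ordering_cone Y (c + e *: d) /\ ordering_cone Y (c - e *: d).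
Proof.
have cont : (fun t : R => c + t *: d) @ (0 : R) --> c + (0 : R) *: d.
  by apply: cvgD; [exact: cvg_cst|apply: cvgZr_tmp; exact: cvg_id].
rewrite scale0r addr0 in cont.
have := cont _ c_int; rewrite nbhs_simpl /= => /nbhs_ballP[e /= e0 ball_e].
have e2 : 0 < e / 2 by rewrite divr_gt0.
exists (e / 2) => //; split.
  apply: ball_e; rewrite /ball /= sub0r normrN gtr0_norm //.
  by rewrite ltr_pdivrMr // ltr_pMr // ltr1n.
rewrite -scaleNr; apply: ball_e; rewrite /ball /= sub0r normrN normrN gtr0_norm //.
by rewrite ltr_pdivrMr // ltr_pMr // ltr1n.
Qed.

(** With [d = w], some [c - e w] lies in the cone, so [w^T c >= e w^T w > 0]. *)
Lemma interior_dot_gt0 w : nonneg (Y^T *m w) -> w != 0 -> 0 < dot w c.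
Proof.
move=> Yw w0; have [e e0 [_ [v v0 vE]]] := interior_ray w.
have : 0 <= dot w (c - e *: w) by rewrite -vE dot_mulmxr nonneg_dot.
by rewrite dotDr dotNr dotZr; have := mulr_gt0 e0 (dot_gt0 w0); lra.
Qed.

(** If [y] is not in the upper image, the linear system [y = P x + Y v], [v >= 0], [x] in [S] is
    infeasible; the separating functional is part of its Farkas certificate, so no topological
    separation argument is used. *)
Lemma upper_image_separation y : (exists y, UI y) -> ~ UI y ->
  exists w t, [/\ nonneg (Y^T *m w), dot w y < t
    & forall y', UI y' -> t <= dot w y'].
Proof.
move=> [y0 UIy0] nUIy.
pose J := (('I_r.+1 + 'I_r.+1) + ('I_o + @constraint n m))%type.
pose X := ('cV[R]_n * 'cV[R]_o)%type.
pose g (k : J) (z : X) : R := match k with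
  | inl (inl i) => (P *m z.1 + Y *m z.2) i 0
  | inl (inr i) => - (P *m z.1 + Y *m z.2) i 0
  | inr (inl j) => z.2 j 0
  | inr (inr k) => constraint_lin B a b l s k z.1
  end.
pose h (k : J) : R := match k with
  | inl (inl i) => - y i 0
  | inl (inr i) => y i 0
  | inr (inl j) => 0
  | inr (inr k) => constraint_cst a b l s k
  end.
have gl k : scalar (g k).
  move: k => [[i|i]|[j|k]] t z1 z2; rewrite /g /= ?mulmxDr -?scalemxAr ?mxE;
    try ring.
  exact: constraint_scalar.
have nfeas z : ~ forall k, k \in index_enum J -> 0 <= g k z + h k.
  move=> zsys; apply: nUIy.
  have {}zsys k : 0 <= g k z + h k by apply: zsys; rewrite mem_index_enum.
  exists z.1.
    apply/(primal_feasibleP _ a_lty b_gtNy l_lty s_gtNy) => k.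
    by have := zsys (inr (inr k)).
  exists (Y *m z.2).
    by exists z.2 => // j; have := zsys (inr (inl j)); rewrite /= addr0.
  apply/colP => i; have := zsys (inl (inl i)); have := zsys (inl (inr i)).
  by rewrite /=; lra.
have [lam lam0 cert] := infeasible_farkas (index_enum_uniq _) gl nfeas.
(* The equation was entered as two opposite inequalities, so its multiplier is a difference of
   unrestricted sign; [kap] collects the multipliers of [v >= 0]. *)
pose w : 'cV[R]_r.+1 := \col_i (lam (inl (inr i)) - lam (inl (inl i))).
pose kap : 'cV[R]_o := \col_j lam (inr (inl j)).
have {}cert x v : S x -> dot w (y - (P *m x + Y *m v)) + dot kap v <= - 1.
  move=> Sx; apply: le_trans (cert (x, v)).
  rewrite 3!big_sumType /= !dotE.
  have -> : \sum_i w i 0 * (y - (P *m x + Y *m v)) i 0 =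
      \sum_i lam (inl (inl i)) * ((P *m x + Y *m v) i 0 - y i 0) +
      \sum_i lam (inl (inr i)) * (- (P *m x + Y *m v) i 0 + y i 0).
    by rewrite -big_split; apply: eq_bigr => i _; rewrite !mxE /=; ring.
  have -> : \sum_i kap i 0 * v i 0 = \sum_i lam (inr (inl i)) * (v i 0 + 0).
    by apply: eq_bigr => i _; rewrite mxE addr0.
  rewrite addrA lerDl sumr_ge0 // => k _; rewrite mulr_ge0 //.
  exact: (primal_feasibleP _ a_lty b_gtNy l_lty s_gtNy x).1.
have [x0 Sx0 _] := UIy0.
have Yw : nonneg (Y^T *m w).
  move=> j; rewrite -dot_delta -dot_mulmxr.
  have kap0 : 0 <= dot kap (delta_mx j 0) by rewrite dot_delta mxE.
  apply: le_trans kap0 _; rewrite -subr_ge0.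
  (* The certificate holds at [v = t e_j] for all [t >= 0], so its slope in [t] cannot be
     positive. *)
  apply: (@affine_ray_ge0 _ (- 1 - dot w (y - P *m x0))) => t t0.
  have := cert x0 (t *: delta_mx j 0) Sx0.
  rewrite -scalemxAr !(dotDr, dotNr, dotZr); lra.
(* The gap of [1] is the bound [-1] of the certificate. *)
exists w, (dot w y + 1); split; rewrite ?ltrDl //.
move=> _ [x Sx [_ [v v0 <-] <-]].
have := cert x 0 Sx; rewrite mulmx0 addr0 dot0r addr0 !(dotDr, dotNr).
by rewrite [dot w (Y *m v)]dot_mulmxr; have := nonneg_dot Yw v0; lra.
Qed.

(** A functional separating [y] from the upper image has [w^T c > 0], so it can be scaled to
    [c^T w = 1]. Together with its threshold it then encodes a point of the lower image whose
    inequality [y] violates. *)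
Lemma upper_image_bipolar y : (exists y, UI y) ->
  UI y <-> (forall ys, LI ys -> 0 <= phi c (gpoint y) ys).
Proof.
move=> UI0; split=> [UIy ys /(lower_image_polar _ UI0)|polar]; first exact.
apply: contrapT => /(upper_image_separation UI0) [w [t [Yw wy wUI]]].
(* For [w = 0] the separation would read [0 < t <= 0]. *)
have w0 : w != 0.
  apply/eqP => w0; have [y0 /wUI] := UI0; move: wy.
  by rewrite w0 dotC dot0r dotC dot0r; lra.
have wc := interior_dot_gt0 Yw w0.
pose w1 := (dot w c)^-1 *: w; pose t1 := (dot w c)^-1 * t.
pose ys : 'cV[R]_r.+1 := \col_i (if i == last then t1 else sgnc * w1 i 0).
have weq : weight ys = w1.
  apply: weight_uniq => [|j jl]; last by rewrite mxE (negbTE jl).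
  by rewrite dotZr [dot c w]dotC mulVf // gt_eqF.
have : 0 <= phi c (gpoint y) ys.
  apply/polar/(lower_image_polar _ UI0) => y' /wUI ty'.
  rewrite phi_weight weq mulr_ge0 // subr_ge0 /= mul1r mxE eqxx dotZl.
  by rewrite ler_pM2l // invr_gt0.
rewrite phi_weight weq pmulr_rge0 ?normr_gt0 // subr_ge0 /= mul1r mxE eqxx.
by rewrite dotZl ler_pM2l ?invr_gt0 // leNgt wy.
Qed.

End GeometricDuality.

(** * V- and H-representations of polar sets *)

Section Hulls.
Context {R : realType} {V : lmodType R}.
Implicit Types (F : {fset V}) (x y : V).

Lemma sum_fset_delta (M : zmodType) F y (G : V -> M) :
  y \in F -> \sum_(z <- F) (if z == y then G z else 0) = G y.
Proof.
move=> yF; rewrite (bigD1_seq y) ?fset_uniq //= eqxx big1 ?addr0 // => z.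
by move=> /negbTE ->.
Qed.

Lemma conv_hull_gen F y : y \in F -> conv_hull F y.
Proof.
move=> yF; exists (fun z => if z == y then 1 else 0); split.
- by move=> z _; case: eqP.
- exact: (sum_fset_delta (fun=> 1)).
- rewrite -[LHS](sum_fset_delta id yF); apply: eq_bigr => z _.
  by case: eqP => _; rewrite ?scale1r ?scale0r.
Qed.

Lemma cone_hull0 F : cone_hull F 0.
Proof.
exists (fun=> 0); split=> //.
by rewrite big1 // => z _; rewrite scale0r.
Qed.

Lemma cone_hullD F x y : cone_hull F x -> cone_hull F y -> cone_hull F (x + y).
Proof.
move=> [mu [mu0 ->]] [nu [nu0 ->]]; exists (fun z => mu z + nu z); split.
  by move=> z zF; rewrite addr_ge0 ?mu0 ?nu0.
by rewrite -big_split; apply: eq_bigr => z _; rewrite scalerDl.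
Qed.

Lemma cone_hullZ F t x : 0 <= t -> cone_hull F x -> cone_hull F (t *: x).
Proof.
move=> t0 [mu [mu0 ->]]; exists (fun z => t * mu z); split.
  by move=> z zF; rewrite mulr_ge0 ?mu0.
by rewrite scaler_sumr; apply: eq_bigr => z _; rewrite scalerA.
Qed.

Lemma cone_hull_gen F y : y \in F -> cone_hull F y.
Proof.
move=> yF; exists (fun z => if z == y then 1 else 0); split.
  by move=> z _; case: eqP.
rewrite -[LHS](sum_fset_delta id yF); apply: eq_bigr => z _.
by case: eqP => _; rewrite ?scale1r ?scale0r.
Qed.

(** The vertex is the midpoint of its translates by [k] and [- k]. *)
Lemma vertex_no_line (Q : set V) (k : V) : has_vertex Q ->
  (forall y, Q y -> Q (y + k)) -> (forall y, Q y -> Q (y - k)) -> k = 0.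
Proof.
move=> [y [Qy ext]] addk subk.
have half1 : (0 : R) < 2^-1 < (1 : R) by apply/andP; split; lra.
have [|+ _] := ext (y + k) (y - k) 2^-1 (addk _ Qy) (subk _ Qy) half1.
  have -> : 1 - 2^-1 = 2^-1 :> R by field.
  rewrite -scalerDr addrACA subrr addr0 -mulr2n -(scaler_nat 2 y) scalerA.
  by rewrite mulVf ?scale1r // pnatr_eq0.
by move=> /eqP; rewrite -subr_eq0 addrAC subrr add0r => /eqP.
Qed.

End Hulls.

(** * Tagged generators *)

Section Generators.
Context {R : realType} {k : nat}.
Implicit Types (A : {fset (bool * 'cV[R]_k)}) (Q : set 'cV[R]_k).

Lemma mem_points A y : (y \in points_of A) = (gpoint y \in A).
Proof.
apply/imfsetP/idP => [[[[] z] /=]|yA].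
- by rewrite !inE => /andP[zA _] ->.
- by rewrite !inE => /andP[].
- by exists (gpoint y); rewrite //= !inE yA.
Qed.

Lemma mem_directions A y : (y \in directions_of A) = (gdirection y \in A).
Proof.
apply/imfsetP/idP => [[[[] z] /=]|yA].
- by rewrite !inE => /andP[].
- by rewrite !inE => /andP[zA _] ->.
- by exists (gdirection y); rewrite //= !inE yA.
Qed.

Lemma sum_generators (M : zmodType) A (F : bool * 'cV[R]_k -> M) :
  \sum_(e <- A) F e = \sum_(y <- points_of A) F (gpoint y)
    + \sum_(y <- directions_of A) F (gdirection y).
Proof.
rewrite (bigID (@is_point R k)) /=; congr (_ + _).
- rewrite -big_filter -(big_map (@gpoint R k) predT F); apply: perm_big.
  apply: uniq_perm; first by rewrite filter_uniq ?fset_uniq.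
    by rewrite map_inj_uniq ?fset_uniq // => ? ? [].
  move=> [[] y]; rewrite mem_filter /=.
    by rewrite mem_map ?mem_points // => ? ? [].
  by apply/esym/mapP => -[].
- rewrite -big_filter -(big_map (@gdirection R k) predT F); apply: perm_big.
  apply: uniq_perm; first by rewrite filter_uniq ?fset_uniq.
    by rewrite map_inj_uniq ?fset_uniq // => ? ? [].
  move=> [[] y]; rewrite mem_filter /=.
    by apply/esym/mapP => -[].
  by rewrite mem_map ?mem_directions // => ? ? [].
Qed.

Lemma Vrep_point A Q y : is_Vrep A Q -> gpoint y \in A -> Q y.
Proof.
move=> -> yA; exists y; first by apply: conv_hull_gen; rewrite mem_points.
by exists 0; rewrite ?addr0 //; exact: cone_hull0.
Qed.

Lemma Vrep_ray A Q y d t : is_Vrep A Q -> gdirection d \in A -> 0 <= t ->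
  Q y -> Q (y + t *: d).
Proof.
move=> -> dA t0 [x cx [z cz <-]]; exists x => //; exists (z + t *: d).
  by apply/cone_hullD/cone_hullZ => //; apply: cone_hull_gen; rewrite mem_directions.
by rewrite addrA.
Qed.

(** The generating set of part (ii), with [d] in place of [(0, ..., 0, -1)]. *)
Definition downward_generators (W : {fset 'cV[R]_k}) (d : 'cV[R]_k) :=
  ([fset gpoint w | w in W] `|` [fset gdirection d])%fset.

Lemma mem_downward_point W d w :
  (gpoint w \in downward_generators W d) = (w \in W).
Proof.
rewrite /downward_generators !inE orbF.
apply/imfsetP/idP => [[z /= zW [->]] //|wW]; by exists w.
Qed.

Lemma mem_downward_direction W d z :
  (gdirection z \in downward_generators W d) = (z == d).
Proof.
rewrite /downward_generators !inE; case: imfsetP => [[] //|_] /=.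
by rewrite xpair_eqE.
Qed.

Lemma downward_generatorsD1 W d w :
  (downward_generators W d `\ gpoint w)%fset = downward_generators (W `\ w)%fset d.
Proof.
apply/fsetP => -[[] z]; rewrite in_fsetD1.
  by rewrite !mem_downward_point in_fsetD1 xpair_eqE.
by rewrite !mem_downward_direction.
Qed.

End Generators.

(** * The coupling function [phi] as a nondegenerate pairing *)

Section Pairing.
Context {R : realType} {r : nat}.
Variable c : 'cV[R]_r.+1.
Hypothesis c_last : c ord_max 0 <> 0.
Local Notation last := (@ord_max r).
Local Notation V := 'cV[R]_r.+1.
Local Notation nc := (`|c ord_max 0|).

Let c_neq0 : c last 0 != 0. Proof. exact/eqP. Qed.

Lemma normc_gt0 : 0 < nc. Proof. by rewrite normr_gt0. Qed.

Lemma phi_pointE (y ys : V) :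
  phi c (gpoint y) ys = phi c (gdirection y) ys - nc * ys last 0.
Proof. by rewrite /phi /xi /= mul1r !mul0r subr0. Qed.

Lemma phi_direction_scalar (ys : V) : scalar (fun y => phi c (gdirection y) ys).
Proof.
move=> t y z; rewrite !phi_weight // /= !mul0r !subr0 dot_scalar; ring.
Qed.

Lemma phi_pointD (y d ys : V) :
  phi c (gpoint (y + d)) ys = phi c (gpoint y) ys + phi c (gdirection d) ys.
Proof.
by rewrite !phi_pointE (scalarD _ _ (phi_direction_scalar ys)) addrAC.
Qed.

Lemma phi_direction_c (ys : V) : phi c (gdirection c) ys = nc.
Proof. by rewrite phi_weight //= mul0r subr0 dotC dot_weight ?mulr1. Qed.

(** The gradient of the affine function [phi c e]. *)
Definition slope (e : bool * V) : V :=
  \col_i (if i == last then - xi e * nc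
          else c last 0 * vec e i 0 - vec e last 0 * c i 0).

Lemma phi0 e : phi c e 0 = vec e last 0 * (nc / c last 0).
Proof.
rewrite /phi mxE mulr0 subr0 !big1 ?mulr0 ?add0r ?subr0 // => i _;
  by rewrite mxE mulr0.
Qed.

Lemma phi_slope e ys : phi c e ys = dot (slope e) ys + phi c e 0.
Proof.
rewrite phi0 dot_last mxE eqxx /phi.
under [in RHS]eq_bigr => j jl do rewrite mxE (negbTE jl) mulrBl -!mulrA.
by rewrite sumrB -!mulr_sumr; ring.
Qed.

Lemma affine_phi e : affine_functional (phi c e).
Proof. by exists (slope e), (phi c e 0) => z; exact: phi_slope. Qed.

Lemma phi_lin_scalar e : scalar (fun ys => phi c e ys - phi c e 0).
Proof.
move=> t x y; rewrite (phi_slope e (t *: x + y)) (phi_slope e x) (phi_slope e y).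
by rewrite dot_scalar; ring.
Qed.

Lemma affine_phi_point (ys : V) : affine_functional (fun y => phi c (gpoint y) ys).
Proof.
exists (nc *: weight c ys), (- (nc * ys last 0)) => y.
by rewrite -/(dot _ _) dotZl phi_pointE phi_weight //= mul0r subr0.
Qed.

(** Turns an identity between functions of [ys] into one between generators. The last unit vector
    gives [t = 0], because [phi] of a direction ignores [ys_q]; then [ys = 0] gives [z_q = 0], and
    the other unit vectors give the rest. *)
Lemma phi_hom_inj (z : V) (t : R) :
  (forall ys, phi c (gdirection z) ys = nc * (t * ys last 0)) -> z = 0 /\ t = 0.
Proof.
have c0 := lt0r_neq0 normc_gt0.
have zero_last : phi c (gdirection z) (delta_mx last 0) = phi c (gdirection z) 0.
  rewrite /phi /= !mul0r !subr0; congr (_ * _ + _ * (_ - _));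
    apply: eq_bigr => i il; rewrite !mxE (negbTE il) //.
move=> zt.
have t0 : t = 0.
  move: zero_last; rewrite !zt !mxE !eqxx !mulr0 !mulr1 => /eqP.
  by rewrite mulf_eq0 (negbTE c0) => /eqP.
split=> //.
have {}zt ys : phi c (gdirection z) ys = 0 by rewrite zt t0 mul0r mulr0.
have zl : z last 0 = 0.
  have /eqP := zt 0; rewrite phi0 /=.
  by rewrite mulf_eq0 mulf_eq0 invr_eq0 (negbTE c0) (negbTE c_neq0) !orbF => /eqP.
apply/colP => i; rewrite mxE; case: (eqVneq i last) => [->//|il].
have := zt (delta_mx i 0); rewrite /phi /= zl !mul0r subr0 addr0 (bigD1 i) //=.
rewrite big1 => [|j /andP[_ ji]]; last by rewrite mxE (negbTE ji) mulr0.
rewrite mxE !eqxx mulr1 addr0 => /eqP.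
by rewrite mulf_eq0 (negbTE c_neq0) => /eqP.
Qed.

(** The point [y = 0] detects the last coordinate, the unit vectors the others. *)
Lemma phi_point_inj (ys zs : V) :
  (forall y, phi c (gpoint y) ys = phi c (gpoint y) zs) -> ys = zs.
Proof.
move=> yz.
have dir0 xs : phi c (gdirection 0) xs = 0.
  exact: (scalar0 (phi_direction_scalar xs)).
have l : ys last 0 = zs last 0.
  have := yz 0; rewrite !phi_pointE !dir0 !sub0r => /oppr_inj.
  exact/mulfI/lt0r_neq0/normc_gt0.
apply/colP => i; case: (eqVneq i last) => [->//|il].
have := yz (delta_mx i 0); rewrite !phi_pointE l => /addIr.
have dirE xs : phi c (gdirection (delta_mx i 0)) xs = c last 0 * xs i 0.
  rewrite /phi /= !mul0r subr0 mxE eq_sym (negbTE il) mul0r addr0; congr (_ * _).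
  rewrite (bigD1 i) //= big1 => [|j /andP[_ ji]]; last first.
    by rewrite mxE (negbTE ji) mul0r.
  by rewrite mxE !eqxx mul1r addr0.
by rewrite !dirE => /(mulfI c_neq0).
Qed.

(** Point weights of sum one make the term [|c_q| ys_q] appear exactly once. *)
Lemma phi_combination (F G : {fset V}) (lam mu : V -> R) ys :
  \sum_(y <- F) lam y = 1 ->
  phi c (gpoint (\sum_(y <- F) lam y *: y + \sum_(d <- G) mu d *: d)) ys =
  \sum_(y <- F) lam y * phi c (gpoint y) ys
  + \sum_(d <- G) mu d * phi c (gdirection d) ys.
Proof.
move=> lam1; have dl := phi_direction_scalar ys.
rewrite phi_pointE (scalarD _ _ dl) !(scalar_sum _ _ dl).
under eq_bigr => y _ do rewrite (scalarZ _ _ dl).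
under [X in _ + X - _]eq_bigr => y _ do rewrite (scalarZ _ _ dl).
under [in RHS]eq_bigr => y _ do rewrite phi_pointE mulrBr.
by rewrite sumrB -mulr_suml lam1 mul1r addrAC.
Qed.

Lemma phi_affine_combination (F : {fset V}) (lam : V -> R) (e : bool * V) zs :
  \sum_(w <- F) lam w = 1 ->
  phi c e (\sum_(w <- F) lam w *: w + zs) =
  \sum_(w <- F) lam w * phi c e w + dot (slope e) zs.
Proof.
move=> lam1; have sl := dot_scalar (slope e).
rewrite phi_slope dotDr (scalar_sum _ _ sl).
under eq_bigr => w _ do rewrite dotZr.
under [in RHS]eq_bigr => w _ do rewrite phi_slope mulrDr.
by rewrite big_split /= -mulr_suml lam1; ring.
Qed.

Lemma slope_point_last y : slope (gpoint y) last 0 = - nc.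
Proof. by rewrite mxE eqxx /= mulN1r. Qed.

End Pairing.

(** * Exchanging V- and H-representations of a polar pair *)

Section Representations.
Context {R : realType} {r : nat}.
Variable c : 'cV[R]_r.+1.
Hypothesis c_last : c ord_max 0 <> 0.
Local Notation last := (@ord_max r).
Local Notation V := 'cV[R]_r.+1.
Local Notation nc := (`|c ord_max 0|).
Variables U L : set V.
Hypothesis U_vertex : has_vertex U.
Hypothesis L_polar :
  forall ys, L ys <-> (forall y, U y -> 0 <= phi c (gpoint y) ys).
Hypothesis U_polar :
  forall y, U y <-> (forall ys, L ys -> 0 <= phi c (gpoint y) ys).

Let nc_gt0 : 0 < nc. Proof. exact: normc_gt0. Qed.

(** By bipolarity a direction that is nonnegative on [L] translates [U] into itself; if [d] and
    [- d] both did, [U] would contain a line through its vertex. *)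
Lemma vertex_neq_recession d : d != 0 ->
  (forall ys, L ys -> 0 <= phi c (gdirection d) ys) ->
  ~ (forall ys, L ys -> 0 <= phi c (gdirection (- d)) ys).
Proof.
have move_in k y : (forall ys, L ys -> 0 <= phi c (gdirection k) ys) ->
    U y -> U (y + k).
  move=> rk /U_polar Uy; apply/U_polar => ys Lys.
  by rewrite phi_pointD // addr_ge0 ?Uy ?rk.
move=> d0 rd rNd; move/eqP: d0; apply; apply: vertex_no_line U_vertex _ _ => y Uy.
  exact: move_in.
exact: move_in.
Qed.

(** If [L] were empty, [c] and [- c] would both vacuously be nonnegative on it. *)
Lemma lower_nonempty : exists ys, L ys.
Proof.
apply: contrapT => /forallNP L0.
have c0 : c != 0 by apply: contra_notN c_last => /eqP ->; rewrite mxE.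
by apply: (vertex_neq_recession c0) => ys /L0.
Qed.

Lemma upper_nonempty : exists y, U y.
Proof. by have [y [Uy _]] := U_vertex; exists y. Qed.

Lemma Vrep_upper_Hrep_lower A : is_Vrep A U -> is_Hrep A (phi c) L.
Proof.
move=> AU; split=> [e _|]; first exact: affine_phi.
apply/seteqP; split=> ys /=.
  move=> Lys [[] y] yA.
    by move/L_polar: Lys; apply; exact: Vrep_point AU yA.
  have [y0 Uy0] := upper_nonempty.
  apply: (@affine_ray_ge0 _ (phi c (gpoint y0) ys)) => t t0.
  have dl := phi_direction_scalar c_last ys.
  rewrite -(scalarZ _ _ dl) -phi_pointD //.
  by move/L_polar: Lys; apply; exact: Vrep_ray AU yA t0 Uy0.
move=> ysA; apply/L_polar => y; rewrite AU.
move=> [_ [lam [lam0 lam1 ->]] [_ [mu [mu0 ->]] <-]].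
rewrite phi_combination // !big_seq addr_ge0 // sumr_ge0 // => z zA.
  by rewrite mulr_ge0 ?lam0 // ysA // -mem_points.
by rewrite mulr_ge0 ?mu0 // ysA // -mem_directions.
Qed.

(** Farkas' lemma for the system [A], read back in terms of generators: [t = 1] treats [z] as a
    point, [t = 0] as a direction. The multiple of [c] stems from the constant in Farkas' lemma. *)
Lemma Hrep_lower_cone A (z : V) (t : R) : is_Hrep A (phi c) L ->
  (forall ys, L ys -> 0 <= phi c (gdirection z) ys - nc * (t * ys last 0)) ->
  exists (lam : bool * V -> R) (tau : R), [/\ forall e, 0 <= lam e, 0 <= tau,
    t = \sum_(y <- points_of A) lam (gpoint y) &
    z = \sum_(y <- points_of A) lam (gpoint y) *: y
      + \sum_(d <- directions_of A) lam (gdirection d) *: d + tau *: c].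
Proof.
move=> [_ LA] zt; have [ys0 Lys0] := lower_nonempty.
have split_phi e ys : (phi c e ys - phi c e 0) + phi c e 0 = phi c e ys.
  by rewrite subrK.
have target_scalar : scalar (fun ys =>
    phi c (gdirection z) ys - phi c (gdirection z) 0 - nc * (t * ys last 0)).
  move=> u x y; rewrite (phi_lin_scalar c (gdirection z) u x y) !mxE; ring.
have [||lam [mu [lam0 mu0 comb]]] := @affine_farkas R V _ (enum_fset A)
    (fun e ys => phi c e ys - phi c e 0) (fun e => phi c e 0)
    _ (phi c (gdirection z) 0) ys0
    (fset_uniq A) (phi_lin_scalar c) target_scalar.
- by move=> e eA; rewrite split_phi; move: Lys0; rewrite LA; exact.
- move=> ys ysA; rewrite addrAC split_phi; apply: zt; rewrite LA => e eA.
  by rewrite -(split_phi e) ysA.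
(* As [phi] of the direction [c] is constantly [|c_q|], the constant [mu] is [phi] of the direction
   [(mu / |c_q|) c]. *)
exists lam, (mu / nc); have tau0 : 0 <= mu / nc by rewrite divr_ge0.
pose lz := \sum_(y <- points_of A) lam (gpoint y) *: y.
pose lt := \sum_(y <- points_of A) lam (gpoint y).
pose ld := \sum_(d <- directions_of A) lam (gdirection d) *: d.
have [|/eqP + /eqP] :=
  @phi_hom_inj R r c c_last (z - (lz + ld + mu / nc *: c)) (t - lt).
  move=> ys; have dl := phi_direction_scalar c_last ys.
  have dirZ u y : u * phi c (gdirection y) ys = phi c (gdirection (u *: y)) ys.
    by rewrite (scalarZ _ _ dl).
  rewrite -scaleN1r addrC (dl (-1)) mulN1r 2!(scalarD _ _ dl) !(scalar_sum _ _ dl).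
  rewrite (scalarZ _ _ dl) phi_direction_c // divfK ?lt0r_neq0 //.
  have combE : phi c (gdirection z) ys - nc * (t * ys last 0) =
      \sum_(y <- points_of A) phi c (gdirection (lam (gpoint y) *: y)) ys
      - lt * (nc * ys last 0)
      + \sum_(d <- directions_of A) phi c (gdirection (lam (gdirection d) *: d)) ys
      + mu.
    rewrite -(split_phi (gdirection z)) addrAC comb sum_generators; congr (_ + _ + _).
      rewrite mulr_suml -sumrB; apply: eq_bigr => y _.
      by rewrite split_phi phi_pointE mulrBr dirZ.
    by apply: eq_bigr => y _; rewrite split_phi dirZ.
  by lra.
by rewrite !subr_eq0 => /eqP zE /eqP tE; split.
Qed.

(** Both [c + e d] and [c - e d] have the form [k_i + tau_i c] with [k_i] generated by [A], so
    [k1 + k2 = (2 - tau1 - tau2) c]. A positive coefficient yields [c]; otherwise the absence of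
    lines forces [k1 = 0], making [d] parallel to [c]. For [q = 1] every [d] is parallel to [c]. *)
Lemma c_in_directions A : (0 < r)%N ->
  (forall d, exists2 e : R, 0 < e &
     forall ys, L ys -> 0 <= phi c (gdirection (c + e *: d)) ys /\
                        0 <= phi c (gdirection (c - e *: d)) ys) ->
  is_Hrep A (phi c) L -> cone_hull (directions_of A) c.
Proof.
move=> r0 rays AL.
(* For [q >= 2] this vector has last coordinate zero, whereas [c_q <> 0]. *)
pose d : V := delta_mx ord0 0.
have [e e0 re] := rays d.
have dirs z : (forall ys, L ys -> 0 <= phi c (gdirection z) ys) ->
    exists (k : V) (tau : R), [/\ cone_hull (directions_of A) k,
      forall ys, L ys -> 0 <= phi c (gdirection k) ys, 0 <= tau & z = k + tau *: c].
  move=> rz; have [|lam [tau [lam0 tau0 lam_sum zE]]] :=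
    Hrep_lower_cone (z := z) (t := 0) AL.
    by move=> ys Lys; rewrite mul0r mulr0 subr0; exact: rz.
  have kcone : cone_hull (directions_of A)
      (\sum_(d <- directions_of A) lam (gdirection d) *: d).
    by exists (fun d => lam (gdirection d)); split.
  exists (\sum_(d <- directions_of A) lam (gdirection d) *: d), tau; split=> //.
    move=> ys Lys; have dl := phi_direction_scalar c_last ys.
    rewrite (scalar_sum _ _ dl) big_seq sumr_ge0 // => k kA.
    rewrite (scalarZ _ _ dl) mulr_ge0 //; have [_] := AL.
    by move=> LA; move: Lys; rewrite LA; apply; rewrite -mem_directions.
  (* The nonnegative point multipliers sum to [t = 0], so they all vanish. *)
  rewrite {1}zE big_seq big1 ?add0r // => y yA.
  have := esym lam_sum => /eqP; rewrite psumr_eq0 => [/allP/(_ y yA)/eqP ->|//].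
  by rewrite scale0r.
have rN : forall k : V, (forall ys, L ys -> 0 <= phi c (gdirection k) ys) ->
   (forall ys, L ys -> 0 <= phi c (gdirection (- k)) ys) -> k = 0.
  move=> k rk rNk; apply: contrapT => /eqP k0; exact: vertex_neq_recession rk rNk.
have [ys Lys|k1 [tau1 [k1A rk1 tau10 E1]]] := dirs (c + e *: d).
  by have [] := re ys Lys.
have [ys Lys|k2 [tau2 [k2A rk2 tau20 E2]]] := dirs (c - e *: d).
  by have [] := re ys Lys.
have k12 : k1 + k2 = (2 - (tau1 + tau2)) *: c.
  apply/(addIr ((tau1 + tau2) *: c)); rewrite -scalerDl subrK scalerDl addrACA.
  by rewrite -E1 -E2 addrACA subrr addr0 -mulr2n -(scaler_nat 2 c).
have [tau_lt|tau_ge] := ltP (tau1 + tau2) 2.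
  have -> : c = (2 - (tau1 + tau2))^-1 *: (k1 + k2).
    by rewrite k12 scalerA mulVf ?scale1r //; lra.
  by apply: cone_hullZ (cone_hullD k1A k2A); rewrite invr_ge0; lra.
have k1_eq0 : k1 = 0.
  apply: rN => // ys Lys; have dl := phi_direction_scalar c_last ys.
  (* Hence [- k1] is a sum of directions that are nonnegative on [L], as is [k1] itself. *)
  have -> : - k1 = k2 + (tau1 + tau2 - 2) *: c.
    apply/eqP; rewrite eq_sym -subr_eq0 opprK addrAC [k2 + k1]addrC k12 -scalerDl.
    by rewrite addrC subrKA subrr scale0r.
  rewrite (scalarD _ _ dl) (scalarZ _ _ dl) phi_direction_c // addr_ge0 ?rk2 //.
  by rewrite mulr_ge0 //; lra.
have ord0_neq : ord0 != last by rewrite -val_eqE /= eq_sym -lt0n.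
have tau1_eq1 : tau1 = 1.
  move: E1; rewrite k1_eq0 add0r => /(congr1 (fun v : V => v last 0)).
  rewrite !mxE eq_sym (negbTE ord0_neq) mulr0 addr0 => /eqP.
  rewrite -subr_eq0 -{1}[c last 0]mul1r -mulrBl mulf_eq0 => /orP[|/eqP //].
  by rewrite subr_eq0 => /eqP.
move: E1; rewrite k1_eq0 tau1_eq1 add0r scale1r => /eqP.
rewrite addrC -subr_eq0 addrK => /eqP/(congr1 (fun v : V => v ord0 0)).
by rewrite !mxE !eqxx mulr1 => e_eq0; rewrite e_eq0 ltxx in e0.
Qed.

(** [Hrep_lower_cone] at [t = 1] leaves a multiple of [c], which the directions of [A] absorb by
    [c_in_directions]. *)
Lemma Hrep_lower_Vrep_upper A : (0 < r)%N ->
  (forall d, exists2 e : R, 0 < e &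
     forall ys, L ys -> 0 <= phi c (gdirection (c + e *: d)) ys /\
                        0 <= phi c (gdirection (c - e *: d)) ys) ->
  is_Hrep A (phi c) L -> is_Vrep A U.
Proof.
move=> r0 rays AL; have cA := c_in_directions r0 rays AL.
apply/seteqP; split=> y.
  move=> /U_polar Uy.
  have [|lam [tau [lam0 tau0 lam1 ->]]] := Hrep_lower_cone (z := y) (t := 1) AL.
    by move=> ys Lys; rewrite mul1r -phi_pointE; exact: Uy.
  exists (\sum_(y <- points_of A) lam (gpoint y) *: y).
    by exists (fun y => lam (gpoint y)); split.
  exists (\sum_(d <- directions_of A) lam (gdirection d) *: d + tau *: c).
    apply: cone_hullD; last exact: cone_hullZ.
    by exists (fun d => lam (gdirection d)); split.
  by rewrite addrA.
move=> [_ [lam [lam0 lam1 ->]] [_ [mu [mu0 ->]] <-]]; apply/U_polar => ys Lys.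
have ysA e : e \in A -> 0 <= phi c e ys.
  by have [_ LA] := AL; move: Lys; rewrite LA; apply.
rewrite phi_combination // !big_seq addr_ge0 // sumr_ge0 // => z zA.
  by rewrite mulr_ge0 ?lam0 // ysA // -mem_points.
by rewrite mulr_ge0 ?mu0 // ysA // -mem_directions.
Qed.

Lemma lower_downward zs t : 0 <= t -> L zs -> L (zs + t *: - delta_mx last 0).
Proof.
move=> t0 /L_polar Lzs; apply/L_polar => y Uy.
rewrite phi_slope dotDr dotZr dotNr dot_delta slope_point_last opprK addrAC.
by rewrite -phi_slope addr_ge0 ?Lzs ?mulr_ge0.
Qed.

(** The same exchange with the roles of the arguments of [phi] reversed. Moving along the downward
    direction raises [phi] of any point at the constant rate [|c_q|], so this direction accounts for
    the constant in Farkas' lemma. *)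
Lemma Vrep_lower_Hrep_upper W :
  is_Vrep (downward_generators W (- delta_mx last 0)) L <->
  is_Hrep W (fun ys y => phi c (gpoint y) ys) U.
Proof.
set e := - delta_mx last 0.
have ptsE : points_of (downward_generators W e) = W.
  by apply/fsetP => w; rewrite mem_points mem_downward_point.
have dirsE : directions_of (downward_generators W e) = [fset e]%fset.
  by apply/fsetP => w; rewrite mem_directions mem_downward_direction inE.
have slope_e y : dot (slope c (gpoint y)) e = nc.
  by rewrite dotNr dot_delta slope_point_last opprK.
have genP ys : minkowski_sum (conv_hull W) (cone_hull [fset e]%fset) ys <->
    exists lam tau, [/\ forall w, w \in W -> 0 <= lam w, \sum_(w <- W) lam w = 1,
      0 <= tau & ys = \sum_(w <- W) lam w *: w + tau *: e].
  split=> [[_ [lam [lam0 lam1 ->]] [_ [mu [mu0 ->]] <-]]|].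
    exists lam, (mu e); rewrite big_seq_fset1; split=> //.
    by rewrite mu0 // inE.
  move=> [lam [tau [lam0 lam1 tau0 ->]]].
  exists (\sum_(w <- W) lam w *: w); first by exists lam.
  by exists (tau *: e) => //; exists (fun=> tau); rewrite big_seq_fset1.
split=> [LW|[_ UW]].
  split=> [ys _|]; first exact: affine_phi_point.
  apply/seteqP; split=> y /=.
    by move=> /U_polar Uy w wW; apply: Uy; apply: Vrep_point LW _;
      rewrite mem_downward_point.
  move=> yW; apply/U_polar => ys; rewrite LW ptsE dirsE.
  move=> /genP[lam [tau [lam0 lam1 tau0 ->]]].
  rewrite phi_affine_combination // dotZr slope_e addr_ge0 ?mulr_ge0 //.
  by rewrite big_seq sumr_ge0 // => w wW; rewrite mulr_ge0 ?lam0 ?yW.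
rewrite /is_Vrep ptsE dirsE; apply/seteqP; split=> ys; last first.
  move=> /genP[lam [tau [lam0 lam1 tau0 ->]]]; apply/L_polar => y Uy.
  rewrite phi_affine_combination // dotZr slope_e addr_ge0 ?mulr_ge0 //.
  rewrite big_seq sumr_ge0 // => w wW; rewrite mulr_ge0 ?lam0 //.
  by move: Uy; rewrite UW; exact.
move=> /L_polar Lys; apply/genP; have [y0 Uy0] := upper_nonempty.
have [||lam [mu [lam0 mu0 comb]]] := @affine_farkas R V _ (enum_fset W)
    (fun w y => phi c (gdirection y) w) (fun w => - (nc * w last 0))
    (fun y => phi c (gdirection y) ys) (- (nc * ys last 0)) y0
    (fset_uniq W) (phi_direction_scalar c_last) (phi_direction_scalar c_last ys).
- by move=> w wW; rewrite -phi_pointE; move: Uy0; rewrite UW; exact.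
- move=> y yW; rewrite -phi_pointE; apply: Lys; rewrite UW => w wW.
  by rewrite phi_pointE yW.
have {}comb y : phi c (gpoint y) ys = \sum_(w <- W) lam w * phi c (gpoint y) w + mu.
  rewrite phi_pointE comb; congr (_ + _); apply: eq_bigr => w _.
  by rewrite phi_pointE.
(* From [y = 0] to [y = c] every [phi c (gpoint y) w] grows by [|c_q|], so both sides of [comb] grow
   equally only if the weights sum to one. *)
have lam1 : \sum_(w <- W) lam w = 1.
  have dir0 xs : phi c (gdirection 0) xs = 0.
    exact: (scalar0 (phi_direction_scalar c_last xs)).
  have := comb 0; have := comb c; rewrite !phi_pointE phi_direction_c // dir0.
  under eq_bigr => w _ do rewrite phi_pointE phi_direction_c // mulrBr.
  under [X in _ -> _ = X + _ -> _]eq_bigr => w _ do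
    rewrite phi_pointE dir0 sub0r mulrN.
  rewrite sumrB -mulr_suml sumrN => E1 E2.
  apply: (mulIf (lt0r_neq0 nc_gt0)); lra.
exists lam, (mu / nc); split=> //; first by rewrite divr_ge0.
apply: (phi_point_inj c_last) => y.
by rewrite phi_affine_combination // dotZr slope_e divfK ?lt0r_neq0 // comb.
Qed.

(* A convex hull of finitely many points is bounded, whereas the lower image
   is nonempty and unbounded downwards. *)
Lemma downward_direction_needed W :
  ~ is_Vrep (downward_generators W (- delta_mx last 0)
             `\ gdirection (- delta_mx last 0))%fset L.
Proof.
set e := - delta_mx last 0; set A := (_ `\ _)%fset => LA.
have dirsE : directions_of A = fset0.
  apply/fsetP => w; rewrite mem_directions in_fsetD1 mem_downward_direction.
  by rewrite xpair_eqE inE /= andNb.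
have [zs Lzs] := lower_nonempty.
(* No convex combination of these points has last coordinate below [- M], since every weight is at
   most one. *)
pose M := \sum_(w <- points_of A) `|w last 0|.
suff : (0 : R) <= - 1 by lra.
apply: (@affine_ray_ge0 _ (zs last 0 + M)) => t t0.
have := lower_downward t0 Lzs; rewrite LA dirsE.
move=> [_ [lam [lam0 lam1 ->]] [_ [mu [_ ->]]]].
rewrite big_seq_fset0 addr0 => /(congr1 (fun v : V => v last 0)).
rewrite summxE !mxE !eqxx => E.
have lam_le1 w : w \in points_of A -> lam w <= 1.
  move=> wA; rewrite -lam1 (bigD1_seq w) ?fset_uniq //= lerDl.
  rewrite big_seq_cond sumr_ge0 // => v /andP[vA _]; exact: lam0.
have : - M <= \sum_(w <- points_of A) (lam w *: w) last 0.
  rewrite /M -sumrN big_seq [leRHS]big_seq ler_sum // => w wA; rewrite mxE.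
  have := lam0 w wA; have := lam_le1 w wA.
  have := ler_norm (- w last 0); rewrite normrN; have := normr_ge0 (w last 0).
  by nra.
by rewrite E /=; lra.
Qed.

(** Deleting a point of [W] deletes its inequality and conversely. Only the downward direction has
    no partner, and it can never be omitted. *)
Lemma irredundant_Vrep_lower_Hrep_upper W :
  irredundant_Vrep (downward_generators W (- delta_mx last 0)) L <->
  irredundant_Hrep W (fun ys y => phi c (gpoint y) ys) U.
Proof.
split=> -[rep irr]; split; try exact/Vrep_lower_Hrep_upper.
  move=> w wW /Vrep_lower_Hrep_upper; rewrite -downward_generatorsD1.
  by apply: irr; rewrite mem_downward_point.
move=> [[] z]; rewrite -/(gpoint z) -/(gdirection z).
  rewrite mem_downward_point downward_generatorsD1 => zW.
  by move=> /Vrep_lower_Hrep_upper; exact: irr.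
rewrite mem_downward_direction => /eqP ->; exact: downward_direction_needed.
Qed.

Lemma irredundant_Vrep_upper_Hrep_lower A : (0 < r)%N ->
  (forall d, exists2 e : R, 0 < e &
     forall ys, L ys -> 0 <= phi c (gdirection (c + e *: d)) ys /\
                        0 <= phi c (gdirection (c - e *: d)) ys) ->
  irredundant_Vrep A U <-> irredundant_Hrep A (phi c) L.
Proof.
move=> r0 rays.
have repE D : is_Vrep D U <-> is_Hrep D (phi c) L.
  by split=> [/Vrep_upper_Hrep_lower|/(Hrep_lower_Vrep_upper r0 rays)].
split=> -[/repE rep irr]; split=> // e eA; have := irr e eA;
  by apply: contra_not => /repE.
Qed.

End Representations.

Theorem theorem11 (R : realType) (n m r o : nat)
  (P : 'M[R]_(r.+1, n)) (B : 'M[R]_(m, n))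
  (a b : 'cV[\bar R]_m) (l s : 'cV[\bar R]_n)
  (Y : 'M[R]_(r.+1, o)) (c : 'cV[R]_r.+1)
  (n_gt0 : (0 < n)%N) (m_gt0 : (0 < m)%N) (o_gt0 : (0 < o)%N)
  (a_lty : forall i, a i 0 <> +oo%E) (b_gtNy : forall i, b i 0 <> -oo%E)
  (l_lty : forall j, l j 0 <> +oo%E) (s_gtNy : forall j, s j 0 <> -oo%E)
  (C_pointed : contains_no_lines (ordering_cone Y))
  (c_int : interior (ordering_cone Y) c)
  (c_last : c ord_max 0 <> 0)
  (P_vertex : has_vertex (upper_image P B a b l s Y)) :
  ((0 < r)%N ->
   forall Ybar : {fset (bool * 'cV[R]_r.+1)},
     irredundant_Vrep Ybar (upper_image P B a b l s Y) <->
     irredundant_Hrep Ybar (phi c) (lower_image P B a b l s Y c)) /\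
  (forall Wbar : {fset 'cV[R]_r.+1},
     irredundant_Vrep
       ([fset gpoint w | w in Wbar] `|`
        [fset gdirection (- delta_mx ord_max 0)])%fset
       (lower_image P B a b l s Y c) <->
     irredundant_Hrep Wbar (fun ys y => phi c (gpoint y) ys)
       (upper_image P B a b l s Y)).
Proof.
have U0 : exists y, upper_image P B a b l s Y y.
  by have [y [Uy _]] := P_vertex; exists y.
have L_polar ys : lower_image P B a b l s Y c ys <-> _ :=
  lower_image_polar a_lty b_gtNy l_lty s_gtNy c_last ys U0.
have U_polar y : upper_image P B a b l s Y y <-> _ :=
  upper_image_bipolar a_lty b_gtNy l_lty s_gtNy c_int c_last y U0.
split=> [r0 Ybar|Wbar]; last exact: irredundant_Vrep_lower_Hrep_upper.
apply: irredundant_Vrep_upper_Hrep_lower => // d.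
(* Elements of the ordering cone are directions of the upper image, hence nonnegative on the lower
   image; this applies to [c + e d] and [c - e d]. *)
have [e e0 [ce cNe]] := interior_ray c_int d; exists e => // ys /L_polar Lys.
have [y0 Uy0] := U0.
have recession k : ordering_cone Y k -> 0 <= phi c (gdirection k) ys.
  move=> Ck; have dl := phi_direction_scalar c_last ys.
  apply: (@affine_ray_ge0 _ (phi c (gpoint y0) ys)) => t t0.
  rewrite -(scalarZ _ _ dl) -phi_pointD //.
  by apply: Lys; exact: upper_image_ray.
by split; exact: recession.
Qed.
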